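(* There is a packing of the Euclidean plane by congruent Reuleaux curved triangles whose density is $$\frac{2(\pi-\sqrt3)}{\sqrt{15}+\sqrt7-2\sqrt3}.$$ (Numerically this is approximately $0.92288$.)
   Context: A Reuleaux curved triangle of width $w$ is the intersection of the three closed disks of radius $w$ centered at the vertices of an equilateral triangle of side $w$ (its boundary is a curve of constant width $w$). A packing is a family of congruent copies of the region (images under isometries of the plane) with pairwise disjoint interiors. Its density is the fraction of the plane covered; for a packing periodic under a lattice, this is the area covered by the copies in a fundamental domain of the lattice divided by the area of that fundamental domain. *)

(* Defs.v *)
From HB Require Import structures.
From mathcomp Require Import all_boot all_order all_algebra.
From mathcomp Require Import all_classical all_reals all_analysis.
Set Implicit Arguments.
Unset Strict Implicit.
Unset Printing Implicit Defensive.
Import Order.TTheory GRing.Theory Num.Theory.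
Import numFieldNormedType.Exports.
Local Open Scope classical_set_scope.
Local Open Scope ring_scope.

(* The plane is [R * R].  The library norm on a product is the sup norm, so
   the Euclidean distance is defined explicitly; both induce the product
   topology, hence the library's [interior] is the Euclidean one. *)
Definition edist (R : realType) (p q : R * R) : R :=
  Num.sqrt ((p.1 - q.1) ^+ 2 + (p.2 - q.2) ^+ 2).

Definition closed_disk (R : realType) (c : R * R) (r : R) : set (R * R) :=
  [set p | edist p c <= r].

Definition plane_isometry (R : realType) (g : R * R -> R * R) : Prop :=
  forall p q, edist (g p) (g q) = edist p q.

Definition congruent_copy (R : realType) (T X : set (R * R)) : Prop :=
  exists2 g, plane_isometry g & X = g @` T.

Definition reuleaux_triangle (R : realType) (w : R) (T : set (R * R)) : Prop :=
  exists a b c : R * R,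
    [/\ edist a b = w, edist b c = w, edist c a = w &
        T = closed_disk a w `&` closed_disk b w `&` closed_disk c w].

(* [trivIset] is stated on members of [P]: two members whose interiors meet
   are equal. *)
Definition is_packing (R : realType) (T : set (R * R))
    (P : set (set (R * R))) : Prop :=
  (forall X, P X -> congruent_copy T X) /\ trivIset P (@interior (R * R)%type).

Definition area (R : realType) (A : set (R * R)) : R :=
  fine ((@lebesgue_measure R \x @lebesgue_measure R)%E A).

(* The fraction of the plane covered by [P]: the limit, as [r] tends to
   infinity, of the fraction covered of the disk of radius [r] about the
   origin.  For a packing periodic under a lattice the limit exists and is the
   area covered in a fundamental domain divided by the area of that domain. *)
Definition has_density (R : realType) (P : set (set (R * R))) (d : R) : Prop :=
  area ((\bigcup_(X in P) X) `&` closed_disk (0, 0) r)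
    / area (closed_disk (0 : R, 0 : R) r) @[r --> +oo] --> d.

(* Main.v *)
Require Import Defs.
From HB Require Import structures.
From mathcomp Require Import all_boot all_order all_algebra.
From mathcomp Require Import finmap.
From mathcomp Require Import all_classical all_reals all_analysis.
From mathcomp Require Import measurable_realfun ring lra zify.
Import Order.TTheory GRing.Theory Num.Theory.
Import numFieldNormedType.Exports.
Local Open Scope classical_set_scope.
Local Open Scope ring_scope.

(** Let [T] be the Reuleaux triangle with vertices [(-w/2, 0)], [(w/2, 0)] and
    [(0, sqrt 3 w/2)].  The packing consists of the translates of [T] by the
    rectangular lattice generated by [(w, 0)] and [(0, h w)], where
    [h = (sqrt 15 + sqrt 7)/2 - sqrt 3], together with the translates of [-T]
    by the same lattice shifted by [(w/2, sqrt 7 w/2)].  Rows of upright and of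
    upside-down copies thus alternate.

    Why it is a packing.  Two equally oriented copies are separated by their
    horizontal or vertical extent, which is at most [w].  An upright and an
    upside-down copy overlap only if the difference of their centres lies in
    the interior of [T + T = 2 T].  The differences form rows of points at
    consecutive distance [w], and [h] is chosen so that the two rows that meet [2 T]
    cut it exactly along its horizontal chords of length [w]: the lower one
    belongs to the bottom arc (half chord [w/2] in a circle of radius [2 w], at
    distance [sqrt 15 w/2] from its centre), the upper one has its ends on the
    two side arcs (half chord [3 w/2], distance [sqrt 7 w/2]).  This is
    [opposite_disjoint]; [copies_disjoint] collects the cases.

    Why it has the stated density.  Splitting each period rectangle into a lower
    and an upper half gives one cell of area [h w^2/2] per copy, at bounded
    distance from it.  Counting the cells that meet a large disk bounds the
    covered area from both sides, so the density is the quotient of the area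
    of a copy by the area of a cell ([density_cells]).  The upper bound uses
    the closed copies and subadditivity; the lower bound uses their open
    versions, which are disjoint and have the same area.

    The area of [T] is an integral of vertical chords ([area_reuleaux]).  With
    [F] an antiderivative of [sqrt (w^2 - x^2)], the right half contributes
    [(F w - F (w/2)) + (F (w/2) - F 0) - sqrt 3 w^2/4], so only
    [F w - F 0 = pi w^2/4] is needed, and the total is
    [(pi - sqrt 3) w^2/2]. *)

(** * Squares, square roots and Euclidean distance *)

Lemma sqr_lt_bounds {R : realType} (x c : R) : 0 <= c -> x ^+ 2 < c ^+ 2 ->
  - c < x < c.
Proof.
move=> c0; rewrite -(@real_normK _ x) ?num_real// ltr_sqr ?nnegrE//.
by rewrite ltr_norml.
Qed.

Lemma sqr_le_bounds {R : realType} (x c : R) : 0 <= c -> x ^+ 2 <= c ^+ 2 ->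
  - c <= x <= c.
Proof.
move=> c0; rewrite -(@real_normK _ x) ?num_real// ler_sqr ?nnegrE//.
by rewrite ler_norml.
Qed.

Lemma sqr_le_sqrt {R : realType} (y u : R) :
  (y ^+ 2 <= u) = (0 <= u) && (- Num.sqrt u <= y <= Num.sqrt u).
Proof.
have [u0|u0] := leP 0 u; last by rewrite leNgt (lt_le_trans u0)// sqr_ge0.
by rewrite -ler_norml -sqrtr_sqr ler_sqrt.
Qed.

Lemma sqr_lt_sqrt {R : realType} (y u : R) :
  (y ^+ 2 < u) = (- Num.sqrt u < y < Num.sqrt u).
Proof.
have [u0|u0] := ltP 0 u; first by rewrite -ltr_norml -sqrtr_sqr ltr_sqrt.
rewrite ler0_sqrtr// oppr0 ltNge (le_trans u0) ?sqr_ge0//=.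
by apply/esym/negP => /andP[]; lra.
Qed.

(** The square of the Euclidean distance. *)
Definition sqdist {R : realType} (p q : R * R) : R :=
  (p.1 - q.1) ^+ 2 + (p.2 - q.2) ^+ 2.

Lemma sqdist_ge0 {R : realType} (p q : R * R) : 0 <= sqdist p q.
Proof. by rewrite addr_ge0// sqr_ge0. Qed.

Lemma edist_le {R : realType} (p q : R * R) (r : R) : 0 <= r ->
  (Defs.edist p q <= r) = (sqdist p q <= r ^+ 2).
Proof.
move=> r0; rewrite -[LHS](@ler_sqr _ (Defs.edist p q) r) ?nnegrE ?sqrtr_ge0//.
by rewrite sqr_sqrtr// sqdist_ge0.
Qed.

Lemma edist_eq {R : realType} (p q : R * R) (r : R) : 0 <= r ->
  sqdist p q = r ^+ 2 -> Defs.edist p q = r.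
Proof. by move=> r0 pq; rewrite /Defs.edist -/(sqdist p q) pq sqrtr_sqr ger0_norm. Qed.

Lemma edist_triangle {R : realType} (p q s : R * R) :
  Defs.edist p s <= Defs.edist p q + Defs.edist q s.
Proof.
have d0 (u v : R * R) : 0 <= Defs.edist u v := sqrtr_ge0 _.
have d2 (u v : R * R) : Defs.edist u v ^+ 2 = sqdist u v by rewrite sqr_sqrtr ?sqdist_ge0.
rewrite edist_le ?addr_ge0// sqrrD !d2.
set a := p.1 - q.1; set b := p.2 - q.2; set c := q.1 - s.1; set d := q.2 - s.2.
have CS : a * c + b * d <= Defs.edist p q * Defs.edist q s.
  (* Lagrange's identity: the gap in Cauchy-Schwarz is a square. *)
  apply: (le_trans (ler_norm _)).
  rewrite -(@ler_sqr _ `|_|) ?nnegrE ?mulr_ge0// real_normK ?num_real//.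
  rewrite exprMn !d2 /sqdist -/a -/b -/c -/d -subr_ge0.
  rewrite (_ : _ - _ = (a * d - b * c) ^+ 2) ?sqr_ge0//; ring.
have -> : sqdist p s = sqdist p q + (a * c + b * d) *+ 2 + sqdist q s.
  by rewrite /sqdist -/a -/b -/c -/d /a /b /c /d; ring.
by rewrite lerD2r lerD2l lerMn2r.
Qed.

(** A point on the bounding circle is not interior: moving it slightly away from
    the centre leaves the disk. *)
Lemma interior_closed_disk {R : realType} (c : R * R) (r : R) : 0 < r ->
  interior (closed_disk c r : set (R * R)%type) `<=` [set p | sqdist p c < r ^+ 2].
Proof.
move=> r0 p pD; rewrite /= ltNge; apply/negP => rp.
have pcont : (p.1 + t * (p.1 - c.1), p.2 + t * (p.2 - c.2)) @[t --> (0:R)] --> p.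
  have fE (u v : R) : u + t * v @[t --> (0:R)] --> u.
    rewrite -[X in _ --> X]addr0 -[X in _ --> _ + X](mul0r v).
    apply: cvgD; first exact: cvg_cst.
    by apply: cvgM; [exact: cvg_id|exact: cvg_cst].
  by rewrite [X in _ --> X]surjective_pairing; exact: (cvg_pair (fE p.1 _) (fE p.2 _)).
have /pcont nD := pD.
have : \forall t \near 0^'+,
    closed_disk c r (p.1 + t * (p.1 - c.1), p.2 + t * (p.2 - c.2)).
  exact: cvg_at_right_filter nD.
move=> nR; near (0:R)^'+ => t.
have t0 : 0 < t by [].
have : closed_disk c r (p.1 + t * (p.1 - c.1), p.2 + t * (p.2 - c.2)) by near: t.
rewrite /closed_disk/= edist_le; last exact: ltW.
rewrite /sqdist/=.
rewrite (_ : p.1 + t * _ - c.1 = (1 + t) * (p.1 - c.1)); last by ring.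
rewrite (_ : p.2 + t * _ - c.2 = (1 + t) * (p.2 - c.2)); last by ring.
rewrite !exprMn -mulrDr leNgt => /negP; apply.
apply: (lt_le_trans _ (ler_wpM2l (sqr_ge0 _) rp)).
rewrite ltr_pMl ?exprn_gt0//; nra.
Unshelve. all: by end_near.
Qed.

(** * Invariance and computation of areas *)

(** The plane as a product of measurable spaces, and its area measure. *)
Local Notation plane R := (measurableTypeR R * measurableTypeR R)%type.
Local Notation mu2 R := (@lebesgue_measure R \x @lebesgue_measure R)%E.

Lemma measurable_affine {R : realType} (s t : R) :
  measurable_fun (setT : set (measurableTypeR R))
    ((fun x => s * x + t) : _ -> measurableTypeR R).
Proof. by apply: measurable_funD => //; exact: measurable_funM. Qed.

(** Maps [x |-> s x + t] with [s = 1] or [s = -1] preserve Lebesgue measure. *)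
Lemma lebesgue_measure_affine {R : realType} (s t : R) : s = 1 \/ s = -1 ->
  forall A : set (measurableTypeR R), measurable A ->
  lebesgue_measure [set x : measurableTypeR R | A (s * x + t)] =
  lebesgue_measure A.
Proof.
move=> s1.
pose m := measure_function_pushforward__canonical__measure_function_Measure
  lebesgue_measure (measurable_affine s t).
move=> A mA; rewrite [RHS](@lebesgue_measure_unique R m)// => _ [[a b] _ <-].
rewrite lebesgue_measure_itv/= /m /pushforward /=.
case: s1 => s1; rewrite s1.
  rewrite (_ : _ @^-1` _ = `]a - t, b - t]%classic); last first.
    by apply/seteqP; split => x /=; rewrite !in_itv/=; lra.
  rewrite lebesgue_measure_itv/= !lte_fin ltrD2r; case: ifP => // _.
  by rewrite -!EFinB; congr EFin; ring.
rewrite (_ : _ @^-1` _ = `[t - b, t - a[%classic); last first.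
  by apply/seteqP; split => x /=; rewrite !in_itv/=; lra.
rewrite lebesgue_measure_itv/= !lte_fin ltrD2l ltrN2; case: ifP => // _.
by rewrite -!EFinB; congr EFin; ring.
Qed.

Lemma measurable_affine2 {R : realType} (s : R) (c : R * R) :
  measurable_fun setT (fun p : plane R =>
    (s * p.1 + c.1, s * p.2 + c.2) : plane R).
Proof.
by apply/measurable_fun_pair => /=; apply: (measurableT_comp (measurable_affine s _)).
Qed.

(** Translations and point reflections of the plane preserve area: they do so on
    rectangles, and these determine the product measure. *)
Lemma area_affine {R : realType} (s : R) (c : R * R) : s = 1 \/ s = -1 ->
  forall A : set (plane R), measurable A ->
  mu2 R [set p | A (s * p.1 + c.1, s * p.2 + c.2)] = mu2 R A.
Proof.
move=> s1.
pose m := measure_function_pushforward__canonical__measure_function_Measure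
  (mu2 R) (measurable_affine2 s c).
move=> A mA; rewrite [RHS](@product_measure_unique _ _ _ _ _ _ _ m)// => B C mB mC.
have mp t X : measurable X -> measurable [set x : measurableTypeR R | X (s * x + t)].
  by move=> mX; rewrite -[X in measurable X]setTI; exact: measurable_affine.
have -> : m (B `*` C) = mu2 R ([set x | B (s * x + c.1)] `*`
                              [set x | C (s * x + c.2)]) by [].
rewrite product_measure1E; [|exact: mp|exact: mp].
by congr (_ * _)%E; exact: lebesgue_measure_affine.
Qed.

Lemma measurable_sqdist {R : realType} (c : R * R) :
  measurable_fun setT (fun p : plane R => sqdist p c).
Proof.
apply: measurable_funD; apply: measurable_funX;
  apply: measurable_funB => //; exact: measurable_cst.
Qed.

Lemma measurable_closed_disk {R : realType} (c : R * R) (r : R) :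
  measurable (closed_disk c r : set (plane R)).
Proof.
have [r0|r0] := leP 0 r; last first.
  rewrite (_ : closed_disk c r = set0)//; apply/seteqP; split => // p.
  by rewrite /closed_disk/= leNgt (lt_le_trans r0)// sqrtr_ge0.
have := @measurable_fun_ler _ _ R setT _ _
  (measurable_sqdist c) (measurable_cst (r ^+ 2)).
move=> /(_ measurableT [set true] I); rewrite setTI.
congr measurable; apply/seteqP; split => p.
  by rewrite /closed_disk/= edist_le// => ->.
by rewrite /closed_disk/= edist_le//.
Qed.

Lemma measurable_open_disk {R : realType} (c : R * R) (r : R) :
  measurable ([set p | sqdist p c < r] : set (plane R)).
Proof.
have := @measurable_fun_ltr _ _ R setT _ _
  (measurable_sqdist c) (measurable_cst r).
move=> /(_ measurableT [set true] I); rewrite setTI.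
by congr measurable; apply/seteqP; split => p /= ->.
Qed.

(** * Integrals of circular arcs *)

Section arc.
Context {R : realType}.

(** Continuity up to the end points, as the inverse of [sin] on a segment. *)
Lemma within_continuous_asin : {within `[-1, 1], continuous (@asin R)}.
Proof.
have -> : (-1 : R) = sin (- (pi / 2)) by rewrite sinN sin_pihalf.
rewrite -[X in `[_, X]]sin_pihalf; apply: segment_can_le_continuous.
- by have := pi_gt0 R; lra.
- exact/continuous_subspaceT/continuous_sin.
- exact: sinK.
Qed.

(** An antiderivative of the height [sqrt (r^2 - x^2)] of a half circle. *)
Definition halfdisk_prim (r x : R) : R :=
  (x * Num.sqrt (r ^+ 2 - x ^+ 2) + r ^+ 2 * asin (x / r)) / 2.

Lemma asin0 : asin 0 = 0 :> R.
Proof. by rewrite -[X in asin X]sin0 sinK// in_itv/=; have := pi_gt0 R; lra. Qed.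

Lemma asin1 : asin 1 = pi / 2 :> R.
Proof. by rewrite -[X in asin X]sin_pihalf sinK// in_itv/=; have := pi_gt0 R; lra. Qed.

Lemma asinN1 : asin (- 1) = - (pi / 2) :> R.
Proof.
rewrite -[X in asin (- X)]sin_pihalf -sinN sinK// in_itv/=.
by have := pi_gt0 R; lra.
Qed.

Lemma halfdisk_prim0 r : halfdisk_prim r 0 = 0.
Proof. by rewrite /halfdisk_prim !mul0r asin0 mulr0 addr0 mul0r. Qed.

Lemma halfdisk_primr r : 0 < r -> halfdisk_prim r r = pi * r ^+ 2 / 4.
Proof.
move=> r0; rewrite /halfdisk_prim subrr sqrtr0 mulr0 add0r divff ?gt_eqF// asin1.
by field.
Qed.

Lemma halfdisk_primNr r : 0 < r -> halfdisk_prim r (- r) = - (pi * r ^+ 2 / 4).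
Proof.
move=> r0; rewrite /halfdisk_prim sqrrN subrr sqrtr0 mulr0 add0r mulNr.
by rewrite divff ?gt_eqF// asinN1; field.
Qed.

Lemma is_derive_halfdisk_prim (r x : R) : 0 < r -> - r < x < r ->
  is_derive x 1 (halfdisk_prim r) (Num.sqrt (r ^+ 2 - x ^+ 2)).
Proof.
move=> r0 /andP[rx xr].
have s0 : 0 < r ^+ 2 - x ^+ 2 by nra.
have xr1 : -1 < x / r < 1 by rewrite ltr_pdivlMr// ltr_pdivrMr//; lra.
have d1 : is_derive x 1 (fun x : R => r ^+ 2 - x ^+ 2) (- (2 * x)).
  by apply: is_derive_eq; rewrite /GRing.scale/=; ring.
have d2 : is_derive x 1 (fun x : R => Num.sqrt (r ^+ 2 - x ^+ 2))
    (- x / Num.sqrt (r ^+ 2 - x ^+ 2)).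
  have := @is_derive1_comp R Num.sqrt (fun x : R => r ^+ 2 - x ^+ 2) _ _ _
    (is_derive1_sqrt s0) d1.
  move/is_derive_eq; apply; field.
  by rewrite gt_eqF// sqrtr_gt0.
have d3 : is_derive x 1 (fun x : R => asin (x / r)) (Num.sqrt (r ^+ 2 - x ^+ 2))^-1.
  have dr : is_derive x 1 (fun x : R => x / r) r^-1.
    by apply: is_derive_eq; rewrite /GRing.scale/=; ring.
  have := @is_derive1_comp R asin (fun x : R => x / r) _ _ _
    (is_derive1_asin xr1) dr.
  move/is_derive_eq; apply; rewrite -invfM; congr (_^-1).
  rewrite -[X in _ * X](ger0_norm (ltW r0)) -[X in _ * X]sqrtr_sqr -sqrtrM; last first.
    by nra.
  by congr Num.sqrt; field; rewrite gt_eqF.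
have d4 := is_deriveM (is_derive_id x 1) d2.
have d5 := is_deriveZ (r ^+ 2) d3.
have d6 := is_deriveZ (2^-1) (is_deriveD d4 d5).
have -> : halfdisk_prim r = 2^-1 \*: (id * (fun x : R => Num.sqrt (r ^+ 2 - x ^+ 2)) +
      r ^+ 2 \*: (fun x : R => asin (x / r))).
  by apply/funext => y; rewrite /halfdisk_prim mulrC.
have sq : Num.sqrt (r ^+ 2 - x ^+ 2) ^+ 2 = r ^+ 2 - x ^+ 2 by rewrite sqr_sqrtr// ltW.
have sn : Num.sqrt (r ^+ 2 - x ^+ 2) != 0 by rewrite gt_eqF// sqrtr_gt0.
set s := Num.sqrt (r ^+ 2 - x ^+ 2) in d6 sq sn *.
move/is_derive_eq : d6; apply; rewrite /GRing.scale/=.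
have -> : r ^+ 2 = s ^+ 2 + x ^+ 2 by rewrite sq; ring.
by field.
Qed.

Lemma continuous_halfdisk_prim (r : R) : 0 < r ->
  {within `[- r, r], continuous (halfdisk_prim r)}.
Proof.
move=> r0; apply/subspace_continuousP => x xr.
apply: cvgM; last exact: cvg_cst.
apply: cvgD.
  apply: cvgM; first exact: cvg_within.
  apply: cvg_trans; last first.
    apply: (@continuous_comp R R R (fun x => r ^+ 2 - x ^+ 2) Num.sqrt x).
      apply: cvgB; first exact: cvg_cst.
      exact: exprn_continuous.
    exact: sqrt_continuous.
  by apply: cvg_app; exact: cvg_within.
apply: cvgM; first exact: cvg_cst.
have /subspace_continuousP asinC := within_continuous_asin.
have xr1 : `[-1, 1]%classic (x / r).
  move: xr; rewrite /= !in_itv/=  ler_pdivlMr// ler_pdivrMr//; lra.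
apply: cvg_comp (asinC _ xr1).
move=> A /=; rewrite /within/= => nA.
have nB : {for x, continuous (fun y : R => y / r)} by exact: mulrr_continuous.
have /= := nB _ nA; apply: (@filterS _ (nbhs x)) => y /= H yr; apply: H.
by move: yr; rewrite /= !in_itv/= ler_pdivlMr// ler_pdivrMr//; lra.
Qed.

Lemma continuous_shift (c : R) : continuous (fun x : R => x + c).
Proof. by move=> x; apply: cvgD; [exact: cvg_id|exact: cvg_cst]. Qed.

Lemma within_continuous_shift (f : R -> R) (a b c a' b' : R) :
  a' <= a + c -> b + c <= b' -> {within `[a', b'], continuous f} ->
  {within `[a, b], continuous (fun x => f (x + c))}.
Proof.
move=> a'a bb' /subspace_continuousP fC; apply/subspace_continuousP => x.
rewrite /= in_itv/= => /andP[ax xb].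
have xc : `[a', b']%classic (x + c) by rewrite /= in_itv/=; lra.
apply: cvg_comp (fC _ xc).
move=> A /=; rewrite /within/= => nA.
have sC : {for x, continuous (fun y : R => y + c)} by exact: continuous_shift.
have /= := sC _ nA; apply: (@filterS _ (nbhs x)) => y /= H; rewrite in_itv/= => yab.
by apply: H; rewrite in_itv/=; lra.
Qed.

(** The area between two arcs of circles of radius [r], with centres horizontally
    [c] and vertically [k] apart.  The case [c = k = 0] is the disk, and
    the two halves of the Reuleaux triangle of width [r] have [c = r/2] and
    [c = - r/2]. *)
Lemma integral_arcs (r a b c k : R) : 0 < r -> a < b ->
  - r <= a -> b <= r -> - r <= a + c -> b + c <= r ->
  (\int[@lebesgue_measure R]_(x in `[a, b])
     (Num.sqrt (r ^+ 2 - (x + c) ^+ 2) + Num.sqrt (r ^+ 2 - x ^+ 2) - k)%:E)%E =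
  (halfdisk_prim r (b + c) + halfdisk_prim r b - k * b -
    (halfdisk_prim r (a + c) + halfdisk_prim r a - k * a))%:E.
Proof.
move=> r0 ab ra br rac bcr.
pose G x := halfdisk_prim r (x + c) + halfdisk_prim r x - k * x.
have dG x : x \in `]a, b[ ->
    is_derive x 1 G (Num.sqrt (r ^+ 2 - (x + c) ^+ 2) + Num.sqrt (r ^+ 2 - x ^+ 2) - k).
  rewrite in_itv/= => /andP[ax xb].
  have d1 : is_derive x 1 (halfdisk_prim r) (Num.sqrt (r ^+ 2 - x ^+ 2)).
    by apply: is_derive_halfdisk_prim => //; lra.
  have d2 : is_derive (x + c) 1 (halfdisk_prim r) (Num.sqrt (r ^+ 2 - (x + c) ^+ 2)).
    by apply: is_derive_halfdisk_prim => //; lra.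
  have d3 : is_derive x 1 (fun x : R => x + c) 1 by apply: is_derive_eq; rewrite addr0.
  have d4 := @is_derive1_comp R _ (fun x : R => x + c) _ _ _ d2 d3.
  have d5 := is_deriveZ k (is_derive_id x (1 : R)).
  have := is_deriveB (is_deriveD d4 d1) d5.
  by move/is_derive_eq; apply; rewrite /GRing.scale/= !mulr1.
have FC := continuous_halfdisk_prim r r0.
have GC : {within `[a, b], continuous G}.
  have kC : {within `[a, b], continuous (fun x => k * x)}.
    by apply: continuous_subspaceT => y; exact: mulrl_continuous.
  have FC' : {within `[a, b], continuous (halfdisk_prim r)}.
    by apply: continuous_subspaceW FC => y /=; rewrite !in_itv/=; lra.
  move=> x; apply: cvgB; last exact: kC.
  apply: cvgD; first exact: (within_continuous_shift _ a b c _ _ rac bcr FC).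
  exact: FC'.
rewrite (continuous_FTC2 ab (F := G)) ?EFinB//.
- apply: continuous_subspaceT => x.
  have sqC (u : R) : {for x, continuous (fun y : R => Num.sqrt (r ^+ 2 - (y + u) ^+ 2))}.
    apply: (@continuous_comp R R R (fun y => r ^+ 2 - (y + u) ^+ 2) Num.sqrt x).
      apply: cvgB; first exact: cvg_cst.
      apply: (@continuous_comp R R R (fun y => y + u) (fun y => y ^+ 2) x).
        exact: continuous_shift.
      exact: exprn_continuous.
    exact: sqrt_continuous.
  apply: cvgB; last exact: cvg_cst.
  apply: cvgD; first exact: sqC.
  have := sqC 0; rewrite (_ : (fun y : R => Num.sqrt (r ^+ 2 - (y + 0) ^+ 2)) =
    (fun y => Num.sqrt (r ^+ 2 - y ^+ 2)))//.
  by apply/funext => y; rewrite addr0.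
- have /continuous_within_itvP -/(_ ab)[_ Ga Gb] := GC.
  by split => // x /dG[].
- by move=> x /dG xG; rewrite derive1E; exact: derive_val.
Qed.

End arc.

(** Cavalieri's principle: area as the integral of the lengths of the vertical
    sections. *)
Lemma area_sections {R : realType} (A : set (plane R)) (a b : R) (h : R -> R) :
  (forall x, a <= x <= b -> lebesgue_measure (xsection A x) = (h x)%:E) ->
  (forall x, ~~ (a <= x <= b) -> xsection A x = set0) ->
  mu2 R A = (\int[@lebesgue_measure R]_(x in `[a, b]) (h x)%:E)%E.
Proof.
move=> hA A0; rewrite [RHS]integral_mkcond /product_measure1.
apply: eq_integral => x _ /=; rewrite patchE.
rewrite mem_setE in_itv/=; case: ifPn; first exact: hA.
by move/A0 => ->; rewrite measure0.
Qed.

Lemma lebesgue_measure_bounded_itv {R : realType} (b0 b1 : bool) (a b : R) :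
  a <= b -> lebesgue_measure
    ([set` Interval (BSide b0 a) (BSide b1 b)] : set (measurableTypeR R)) =
  (b - a)%:E.
Proof.
move=> ab; rewrite lebesgue_measure_itv/= lte_fin; case: ltP => //.
by move=> ba; rewrite (@le_anti _ _ a b) ?ab// subrr.
Qed.

Lemma measure_closed_disk {R : realType} (r : R) : 0 < r ->
  mu2 R (closed_disk (0, 0) r) = (pi * r ^+ 2)%:E.
Proof.
move=> r0.
rewrite (area_sections _ (- r) r (fun x => Num.sqrt (r ^+ 2 - (x + 0) ^+ 2) +
  Num.sqrt (r ^+ 2 - x ^+ 2) - 0)).
- rewrite (integral_arcs r (- r) r 0 0)//; [|lra..].
  by rewrite !addr0 !mul0r halfdisk_primr// halfdisk_primNr//; congr EFin; field.
- move=> x xr; rewrite (_ : xsection _ x =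
    `[- Num.sqrt (r ^+ 2 - x ^+ 2), Num.sqrt (r ^+ 2 - x ^+ 2)]%classic).
    rewrite lebesgue_measure_bounded_itv ?addr0 ?subr0 ?opprK//.
    by have := sqrtr_ge0 (r ^+ 2 - x ^+ 2); lra.
  apply/seteqP; split => y; rewrite /= /xsection/= inE /closed_disk/=
    (edist_le _ _ _ (ltW r0));
    rewrite /sqdist/= !subr0 -lerBrDl sqr_le_sqrt in_itv/=.
    by case/andP.
  by move=> ->; rewrite andbT subr_ge0; nra.
- move=> x xr; apply/seteqP; split => // y; rewrite /xsection/= inE /closed_disk/=.
  rewrite edist_le; last exact: ltW.
  rewrite /sqdist/= !subr0 => h; apply/negP : xr; rewrite negbK.
  by have := sqr_ge0 y; nra.
Qed.

(** * The Reuleaux triangle and its area *)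

(** The vertices of the Reuleaux triangle that is packed; its base is horizontal. *)
Definition vertexA {R : realType} (w : R) : R * R := (- (w / 2), 0).
Definition vertexB {R : realType} (w : R) : R * R := (w / 2, 0).
Definition vertexC {R : realType} (w : R) : R * R := (0, Num.sqrt 3 / 2 * w).

(** The Reuleaux triangle of width [w]. *)
Definition reuleaux {R : realType} (w : R) : set (R * R) :=
  closed_disk (vertexA w) w `&` closed_disk (vertexB w) w
    `&` closed_disk (vertexC w) w.

(** The same triangle with strict inequalities. *)
Definition reuleaux_open {R : realType} (w : R) : set (R * R) :=
  [set p | [/\ sqdist p (vertexA w) < w ^+ 2, sqdist p (vertexB w) < w ^+ 2
             & sqdist p (vertexC w) < w ^+ 2]].

Lemma reuleauxP {R : realType} (w : R) (p : R * R) : 0 <= w ->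
  reuleaux w p <->
  [/\ sqdist p (vertexA w) <= w ^+ 2, sqdist p (vertexB w) <= w ^+ 2
    & sqdist p (vertexC w) <= w ^+ 2].
Proof.
move=> w0; rewrite /reuleaux /closed_disk/= !edist_le//.
by split=> [[[? ?] ?]|[? ? ?]]; split.
Qed.

Lemma sqrt3_sqr {R : realType} : Num.sqrt 3 ^+ 2 = 3 :> R.
Proof. by rewrite sqr_sqrtr. Qed.

Lemma reuleaux_isP {R : realType} (w : R) : 0 < w ->
  reuleaux_triangle w (reuleaux w).
Proof.
move=> w0; exists (vertexA w), (vertexB w), (vertexC w).
have s3 := @sqrt3_sqr R.
split => //; apply: edist_eq; rewrite ?ltW// /sqdist/=.
- by field.
- transitivity (w ^+ 2 / 4 + Num.sqrt 3 ^+ 2 / 4 * w ^+ 2); first by field.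
  by rewrite s3; field.
- transitivity (w ^+ 2 / 4 + Num.sqrt 3 ^+ 2 / 4 * w ^+ 2); first by field.
  by rewrite s3; field.
Qed.

(** The height of the vertical chord of the Reuleaux triangle above [x]. *)
Definition chord {R : realType} (w x : R) : R :=
  Num.sqrt (w ^+ 2 - (`|x| + w / 2) ^+ 2) + Num.sqrt (w ^+ 2 - x ^+ 2)
   - Num.sqrt 3 / 2 * w.

(** For [x >= 0] the chord runs from the arc centred at [vertexC] up to the arc
    centred at [vertexA], the third disk imposing nothing more; for [x <= 0] the
    vertices [vertexA] and [vertexB] are exchanged, hence the absolute value. *)
Lemma reuleaux_chord {R : realType} (w x : R) : 0 < w -> - (w / 2) <= x <= w / 2 ->
  let lo := Num.sqrt 3 / 2 * w - Num.sqrt (w ^+ 2 - x ^+ 2) in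
  let up := Num.sqrt (w ^+ 2 - (`|x| + w / 2) ^+ 2) in
  [/\ lo <= up,
      forall y, reuleaux w (x, y) -> lo <= y <= up &
      forall y, lo < y < up -> reuleaux_open w (x, y)].
Proof.
move=> w0 xw lo up.
have s3 := @sqrt3_sqr R.
have s30 : 0 <= Num.sqrt 3 :> R := sqrtr_ge0 _.
have ax0 := normr_ge0 x.
have axw : `|x| <= w / 2 by rewrite ler_norml.
have ax2 : x ^+ 2 = `|x| ^+ 2 by rewrite real_normK ?num_real.
set a := `|x| in up ax0 axw ax2 *.
have /andP[axl axr] : - a <= x <= a by rewrite -ler_norml.
have u0 : 0 <= w ^+ 2 - (a + w / 2) ^+ 2 by nra.
have v0 : 0 <= w ^+ 2 - a ^+ 2 by nra.
have up2 : up ^+ 2 = w ^+ 2 - (a + w / 2) ^+ 2 by rewrite sqr_sqrtr.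
have up0 : 0 <= up := sqrtr_ge0 _.
pose s := Num.sqrt (w ^+ 2 - x ^+ 2).
have s2 : s ^+ 2 = w ^+ 2 - a ^+ 2 by rewrite sqr_sqrtr ax2.
have s0 : 0 <= s := sqrtr_ge0 _.
have loE : lo = Num.sqrt 3 / 2 * w - s by [].
have lo0 : lo <= 0.
  rewrite loE subr_le0 -(@ler_sqr _ _ s) ?nnegrE//; last first.
    by rewrite mulr_ge0 ?divr_ge0// ltW.
  by rewrite s2 !exprMn s3; nra.
(* The lower end of the chord lies in the disk about the base vertex. *)
have wa : w + a <= Num.sqrt 3 * s.
  rewrite -(@ler_sqr _ _ (Num.sqrt 3 * s)) ?nnegrE ?mulr_ge0//; last by lra.
  by rewrite exprMn s3 s2; nra.
have lo2 : lo ^+ 2 <= up ^+ 2.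
  have -> : lo ^+ 2 = Num.sqrt 3 ^+ 2 / 4 * w ^+ 2 + s ^+ 2 - (Num.sqrt 3 * s) * w.
    by rewrite loE; field.
  by rewrite s3 s2 up2; nra.
have loNup : - up <= lo.
  by rewrite lerNl -(@ler_sqr _ (- lo)) ?nnegrE ?sqrrN// oppr_ge0.
have upC : up <= Num.sqrt 3 / 2 * w.
  rewrite -(@ler_sqr _ up) ?nnegrE//; last by rewrite mulr_ge0 ?divr_ge0// ltW.
  by rewrite up2 !exprMn s3; nra.
split.
- by lra.
- move=> y /(reuleauxP _ _ (ltW w0)) []; rewrite /sqdist/= => hA hB hC.
  have y2 : y ^+ 2 <= w ^+ 2 - (a + w / 2) ^+ 2.
    have [x0|x0] := leP 0 x.
      have -> : a = x by rewrite /a ger0_norm.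
      by move: hA; rewrite subr0; nra.
    have -> : a = - x by rewrite /a ltr0_norm.
    by move: hB; rewrite subr0; nra.
  move: y2; rewrite sqr_le_sqrt => /and3P[_ _ yup]; rewrite yup andbT.
  have : (y - Num.sqrt 3 / 2 * w) ^+ 2 <= w ^+ 2 - x ^+ 2 by move: hC; rewrite subr0; lra.
  by rewrite sqr_le_sqrt => /and3P[_ + _]; rewrite -/s loE; lra.
- move=> y /andP[ylo yup].
  have y2 : y ^+ 2 < w ^+ 2 - (a + w / 2) ^+ 2.
    by rewrite sqr_lt_sqrt -/up yup andbT; lra.
  have yC : (y - Num.sqrt 3 / 2 * w) ^+ 2 < w ^+ 2 - x ^+ 2.
    by rewrite sqr_lt_sqrt -/s; rewrite loE in ylo; lra.
  by split; rewrite /sqdist/= ?subr0; nra.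
Qed.

(** Stated for any set between the open and the closed triangle, as both are
    needed. *)
Lemma area_reuleaux {R : realType} (w : R) (A : set (plane R)) : 0 < w ->
  measurable A -> reuleaux_open w `<=` A -> A `<=` reuleaux w ->
  mu2 R A = ((pi - Num.sqrt 3) / 2 * w ^+ 2)%:E.
Proof.
move=> w0 mA oA Ac.
rewrite (area_sections _ (- (w / 2)) (w / 2) (chord w)); last 2 first.
- move=> x xw; have [lu clo ope] := reuleaux_chord w x w0 xw.
  apply/eqP; rewrite eq_le; apply/andP; split.
  + have -> : chord w x = Num.sqrt (w ^+ 2 - (`|x| + w / 2) ^+ 2) -
      (Num.sqrt 3 / 2 * w - Num.sqrt (w ^+ 2 - x ^+ 2)) by rewrite /chord; ring.
    rewrite -(lebesgue_measure_bounded_itv true false)//.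
    apply: le_measure; rewrite ?inE//.
      exact: measurable_xsection.
    move=> y; rewrite /xsection/= inE => /Ac /clo; by rewrite in_itv.
  + have -> : chord w x = Num.sqrt (w ^+ 2 - (`|x| + w / 2) ^+ 2) -
      (Num.sqrt 3 / 2 * w - Num.sqrt (w ^+ 2 - x ^+ 2)) by rewrite /chord; ring.
    rewrite -(lebesgue_measure_bounded_itv false true)//.
    apply: le_measure; rewrite ?inE//.
      exact: measurable_xsection.
    by move=> y /=; rewrite in_itv/= /xsection/= inE => /ope/oA.
- move=> x xw; apply/seteqP; split => // y; rewrite /xsection/= inE.
  move=> /Ac /(reuleauxP _ _ (ltW w0)) []; rewrite /sqdist/= => hA hB _.
  apply/negP : xw; rewrite negbK; have := sqr_ge0 y; rewrite !subr0 in hA hB.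
  by nra.
have mchord (D : set (measurableTypeR R)) : measurable_fun D (EFin \o chord w).
  apply/measurable_EFinP/measurable_funTS; apply: continuous_measurable_fun.
  move=> x; apply: cvgB; last exact: cvg_cst.
  apply: cvgD.
    apply: (@continuous_comp R R R (fun x => w ^+ 2 - (`|x| + w / 2) ^+ 2) Num.sqrt x).
      apply: cvgB; first exact: cvg_cst.
      apply: (@continuous_comp R R R (fun x => `|x| + w / 2) (fun y => y ^+ 2) x).
        by apply: cvgD; [exact: norm_continuous|exact: cvg_cst].
      exact: exprn_continuous.
    exact: sqrt_continuous.
  apply: (@continuous_comp R R R (fun x => w ^+ 2 - x ^+ 2) Num.sqrt x).
    by apply: cvgB; [exact: cvg_cst|exact: exprn_continuous].
  exact: sqrt_continuous.
rewrite (_ : `[- (w / 2), w / 2]%classic = `[- (w / 2), 0] `|` `]0, w / 2])%classic; last first.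
  by rewrite -itv_bndbnd_setU//; rewrite bnd_simp; lra.
rewrite ge0_integral_setU//=; first last.
- apply/disj_setPS => x /=; rewrite !in_itv/=; lra.
- move=> x xw; have [|lu _ _] := reuleaux_chord w x w0.
    by case: xw; rewrite /= in_itv/=; lra.
  by rewrite lee_fin /chord; lra.
rewrite integral_itv_obnd_cbnd; last exact: mchord.
have left : (\int[@lebesgue_measure R]_(x in `[(- (w / 2))%R, 0%R]) (chord w x)%:E =
    ((pi - Num.sqrt 3) / 4 * w ^+ 2)%:E)%E.
  under eq_integral => x.
    rewrite inE/= in_itv/= => /andP[_ x0].
    rewrite /chord (ler0_norm x0) (_ : - x + w / 2 = - (x + - (w / 2))); last by ring.
    rewrite sqrrN; over.
  rewrite (integral_arcs w (- (w / 2)) 0 (- (w / 2)) (Num.sqrt 3 / 2 * w))//; [|lra..].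
  rewrite (_ : - (w / 2) + - (w / 2) = - w); last by field.
  by rewrite add0r halfdisk_prim0 halfdisk_primNr//; congr EFin; field.
have right : (\int[@lebesgue_measure R]_(x in `[0%R, (w / 2)%R]) (chord w x)%:E =
    ((pi - Num.sqrt 3) / 4 * w ^+ 2)%:E)%E.
  under eq_integral => x.
    rewrite inE/= in_itv/= => /andP[x0 _].
    rewrite /chord (ger0_norm x0); over.
  rewrite (integral_arcs w 0 (w / 2) (w / 2) (Num.sqrt 3 / 2 * w))//; [|lra..].
  rewrite (_ : w / 2 + w / 2 = w); last by field.
  by rewrite add0r halfdisk_prim0 halfdisk_primr//; congr EFin; field.
by rewrite left right -EFinD; congr EFin; field.
Qed.

(** * Density from a partition into cells *)

(** A family of sets [X i], containing disjoint sets [Y i] of the same area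
    [alpha], is spread out along a partition of the plane into cells [Q i] of
    area [beta], the diameter of [X i] together with its cell being at most
    [rho].  Then the union of the [X i] has density [alpha / beta]. *)
Section density.
Context {R : realType} {I : choiceType}.
Variables (X Y Q : I -> set (plane R)) (alpha beta rho : R).
Hypotheses (alpha0 : 0 <= alpha) (beta0 : 0 < beta) (rho0 : 0 < rho).
Hypotheses (mX : forall i, measurable (X i)) (mY : forall i, measurable (Y i))
  (mQ : forall i, measurable (Q i)).
Hypotheses (YX : forall i, Y i `<=` X i) (tY : trivIset setT Y).
Hypotheses (tQ : trivIset setT Q) (QT : \bigcup_i Q i = setT).
Hypotheses (Xalpha : forall i, mu2 R (X i) = alpha%:E)
  (Yalpha : forall i, mu2 R (Y i) = alpha%:E)
  (Qbeta : forall i, mu2 R (Q i) = beta%:E).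
Hypothesis near_cell : forall i p q, (X i `|` Q i) p -> (X i `|` Q i) q ->
  Defs.edist p q <= rho.

Let disk r : set (plane R) := closed_disk (0, 0) r.
(* The indices of the cells that meet the disk of radius [r]. *)
Let meet r : set I := [set i | Q i `&` disk r !=set0].

Let sum_const (J : set I) (Z : I -> set (plane R)) (c : R) : finite_set J ->
  (forall i, mu2 R (Z i) = c%:E) ->
  (\sum_(i \in J) mu2 R (Z i) = (#|` fset_set J|%:R * c)%:E)%E.
Proof.
move=> fJ Zc; rewrite fsbig_finite//=.
under eq_bigr do rewrite Zc.
by rewrite sumEFin big_const_seq count_predT iter_addr_0 mulr_natl.
Qed.

Let disk_fin r : 0 < r -> mu2 R (disk r) = (pi * r ^+ 2)%:E.
Proof. exact: measure_closed_disk. Qed.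

(* Disjoint cells meeting a disk fit in the disk enlarged by [rho]. *)
Let cells_disk (J : set I) r : 0 < r -> finite_set J -> J `<=` meet r ->
  #|` fset_set J|%:R * beta <= pi * (r + rho) ^+ 2.
Proof.
move=> r0 fJ Jr; rewrite -lee_fin -(sum_const _ Q)// -measure_fin_bigcup//; last first.
  exact: sub_trivIset tQ.
rewrite -disk_fin ?addr_gt0//; apply: le_measure.
- by apply/mem_set; exact: fin_bigcup_measurable.
- by apply/mem_set; exact: measurable_closed_disk.
- move=> p [i Ji Qp]; have [q [Qq rq]] := Jr _ Ji.
  apply: (le_trans (edist_triangle p q (0, 0))); rewrite addrC lerD//.
  by apply: (near_cell i); right.
Qed.

(* Infinitely many cells would exceed the area of the enlarged disk. *)
Let finite_meet r : 0 < r -> finite_set (meet r).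
Proof.
move=> r0; apply: contrapT => infJ.
pose n := (Num.truncn (pi * (r + rho) ^+ 2 / beta)).+1.
have [J Jr Jn] := infinite_set_fset n infJ.
have := cells_disk [set` J] r r0 (finite_fset J) Jr.
rewrite set_fsetK -ler_pdivlMr// leNgt => /negP; apply.
by rewrite (lt_le_trans (truncnS_gt _))// ler_nat.
Qed.

(* The number of cells that meet the disk of radius [r]. *)
Let ncells r : R := #|` fset_set (meet r)|%:R.

Let ncells_le r : 0 < r -> ncells r * beta <= pi * (r + rho) ^+ 2.
Proof. by move=> r0; apply: cells_disk => //; exact: finite_meet. Qed.

Let ncells_ge r : 0 < r -> pi * r ^+ 2 <= ncells r * beta.
Proof.
move=> r0; rewrite -lee_fin -(sum_const _ Q)//; last exact: finite_meet.
rewrite -disk_fin//.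
apply: content_sub_fsum => //; [exact: finite_meet|exact: measurable_closed_disk|].
move=> p pr; have : (\bigcup_i Q i) p by rewrite QT.
by move=> [i _ Qp]; exists i => //; exists p.
Qed.

Let U : set (plane R) := \bigcup_(Z in range X) Z.

Let U_sub r : 0 < r ->
  U `&` disk r `<=` \bigcup_(i in meet (r + rho)) X i.
Proof.
move=> r0 p [[_ [i _ <-] Xp] pr]; exists i => //.
have [q Qq] : Q i !=set0.
  apply/set0P/negP => /eqP Q0; have := Qbeta i; rewrite Q0 measure0 => -[b0].
  by move: beta0; rewrite -b0 ltxx.
exists q; split => //; apply: (le_trans (edist_triangle q p (0, 0))).
by rewrite addrC lerD//; apply: (near_cell i); [right|left].
Qed.

Let mU r : 0 < r -> measurable (U `&` disk r).
Proof.
move=> r0; have -> : U `&` disk r = (\bigcup_(i in meet (r + rho)) X i) `&` disk r.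
  apply/seteqP; split => p [Up pr]; split => //; first exact: U_sub.
  by case: Up => i _ Xp; exists (X i) => //; exists i.
apply: measurableI; last exact: measurable_closed_disk.
by apply: fin_bigcup_measurable => //; apply: finite_meet; rewrite addr_gt0.
Qed.

Let area_le r : 0 < r ->
  (mu2 R (U `&` disk r) <= (alpha / beta * (pi * (r + rho + rho) ^+ 2))%:E)%E.
Proof.
move=> r0; have rr0 : 0 < r + rho by rewrite addr_gt0.
apply: (@le_trans _ _ (ncells (r + rho) * alpha)%:E).
  rewrite -(sum_const _ X)//; last exact: finite_meet.
  by apply: content_sub_fsum => //; [exact: finite_meet|exact: mU|exact: U_sub].
rewrite lee_fin -[leRHS]mulrA [leLHS]mulrC ler_wpM2l//.
by rewrite [leRHS]mulrC ler_pdivlMr//; exact: ncells_le.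
Qed.

Let area_ge r : rho < r ->
  ((alpha / beta * (pi * (r - rho) ^+ 2))%:E <= mu2 R (U `&` disk r))%E.
Proof.
move=> r0; have rr0 : 0 < r - rho by rewrite subr_gt0.
apply: (@le_trans _ _ (ncells (r - rho) * alpha)%:E).
  rewrite lee_fin -[leLHS]mulrA [leRHS]mulrC ler_wpM2l//.
  by rewrite [leLHS]mulrC ler_pdivrMr//; exact: ncells_ge.
rewrite -(sum_const _ Y)//; last exact: finite_meet.
rewrite -measure_fin_bigcup//; [|exact: finite_meet|exact: sub_trivIset tY].
apply: le_measure.
- by apply/mem_set; apply: fin_bigcup_measurable => //; exact: finite_meet.
- by apply/mem_set; apply: mU; exact: lt_trans r0.
- move=> p [i [q [Qq qr]] Yp]; split.
    by exists (X i); [exists i|exact: YX].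
  apply: (le_trans (edist_triangle p q (0, 0))).
  rewrite -(subrK rho r) addrC lerD//.
  by apply: (near_cell i); [left; exact: YX|right].
Qed.

Lemma density_cells : has_density (range X) (alpha / beta).
Proof.
have fin r : 0 < r -> area (closed_disk (0 : R, 0 : R) r) = pi * r ^+ 2.
  by move=> r0; rewrite /area measure_closed_disk.
have pi0 := pi_gt0 R.
have lim (c : R) : alpha / beta * (1 + c * r^-1) ^+ 2 @[r --> +oo] --> alpha / beta.
  have inv0 : r^-1 @[r --> +oo] --> (0 : R).
    have /gtr0_cvgV0 -> : \forall r \near +oo, 0 < (r : R) by exact: nbhs_pinfty_gt.
    exact: cvg_id.
  have lim1 : 1 + c * r^-1 @[r --> +oo] --> 1 + c * 0.
    by apply: cvgD; [exact: cvg_cst|apply: cvgM => //; exact: cvg_cst].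
  rewrite mulr0 addr0 in lim1.
  have lim2 : (1 + c * r^-1) ^+ 2 @[r --> +oo] --> (1 * 1 : R) by exact: (cvgM lim1 lim1).
  rewrite mulr1 in lim2; rewrite -[X in _ --> X]mulr1.
  by apply: cvgM; [exact: cvg_cst|exact: lim2].
(* The cell counts at radii [r - rho] and [r + rho] bound the ratio between
   multiples of the areas of the disks of radii [r - rho] and [r + 2 rho]. *)
apply: (squeeze_cvgr _ (lim (- rho)) (lim (2 * rho))).
near=> r.
have r0 : 0 < r by near: r; exact: nbhs_pinfty_gt.
have rr : rho < r by near: r; apply: nbhs_pinfty_gt; rewrite num_real.
have U_fin : mu2 R (U `&` disk r) \is a fin_num.
  rewrite ge0_fin_numE; first by apply: le_lt_trans (area_le _ r0) (ltry _).
  exact: measure_ge0.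
have hle := area_le _ r0; have hge := area_ge _ rr.
rewrite -(fineK U_fin) !lee_fin in hle hge.
rewrite fin// ler_pdivlMr ?mulr_gt0 ?exprn_gt0// ler_pdivrMr ?mulr_gt0 ?exprn_gt0//.
apply/andP; split.
  apply: le_trans hge; rewrite le_eqVlt; apply/orP; left; apply/eqP.
  by field; rewrite !gt_eqF.
apply: (le_trans hle); rewrite le_eqVlt; apply/orP; left; apply/eqP.
by field; rewrite !gt_eqF.
Unshelve. all: by end_near.
Qed.

End density.

(** * Separation of the copies *)

(** The vertical period of the packing, in units of the width. *)
Definition row_height (R : realType) : R := (Num.sqrt 15 + Num.sqrt 7) / 2 - Num.sqrt 3.

Lemma sqrt_between {R : realType} (a l u : R) : 0 <= l -> 0 <= u ->
  l ^+ 2 < a -> a < u ^+ 2 -> l < Num.sqrt a < u.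
Proof.
move=> l0 u0 la au; have a0 : 0 <= a by rewrite (le_trans (sqr_ge0 l))// ltW.
rewrite -(@ltr_sqr _ l) ?nnegrE ?sqrtr_ge0// -(@ltr_sqr _ _ u) ?nnegrE ?sqrtr_ge0//.
by rewrite sqr_sqrtr// la.
Qed.

Lemma sqrt3_bounds {R : realType} : (173 / 100 : R) < Num.sqrt (3 : R) < 174 / 100.
Proof. by apply: sqrt_between; lra. Qed.
Lemma sqrt7_bounds {R : realType} : (264 / 100 : R) < Num.sqrt (7 : R) < 265 / 100.
Proof. by apply: sqrt_between; lra. Qed.
Lemma sqrt15_bounds {R : realType} : (387 / 100 : R) < Num.sqrt (15 : R) < 388 / 100.
Proof. by apply: sqrt_between; lra. Qed.

Lemma row_height_bounds {R : realType} : (15 / 10 : R) < row_height R < 16 / 10.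
Proof.
have := @sqrt3_bounds R; have := @sqrt7_bounds R; have := @sqrt15_bounds R.
by rewrite /row_height; lra.
Qed.

Lemma reuleaux_open_extent {R : realType} (w : R) (q : R * R) : 0 < w ->
  reuleaux_open w q ->
  - (w / 2) < q.1 < w / 2 /\
  Num.sqrt 3 / 2 * w - w < q.2 < Num.sqrt 3 / 2 * w.
Proof.
move=> w0 []; rewrite /sqdist/= !subr0 => hA hB hC.
have y2 := sqr_ge0 q.2.
have s3 := @sqrt3_sqr R; have s3b := @sqrt3_bounds R.
split; apply/andP; split.
- by nra.
- by nra.
- by have := sqr_ge0 q.1; nra.
have : q.2 ^+ 2 < (Num.sqrt 3 / 2 * w) ^+ 2.
  by rewrite !exprMn s3; have := sqr_ge0 q.1; nra.
by have : 0 < Num.sqrt 3 / 2 * w by [rewrite mulr_gt0//; lra]; nra.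
Qed.

(** If [q] and [q'] lie in the open triangle then [q + q'] lies in the open
    Reuleaux triangle of width [2 w] with the doubled vertices; that triangle
    contains no point of the shifted lattice. *)
Lemma opposite_disjoint {R : realType} (w : R) (q q' : R * R) (k m : int) : 0 < w ->
  reuleaux_open w q -> reuleaux_open w q' ->
  q.1 + q'.1 = k%:~R * w + w / 2 ->
  q.2 + q'.2 = m%:~R * (row_height R * w) + Num.sqrt 7 / 2 * w -> False.
Proof.
move=> w0 [qA qB qC] [qA' qB' qC'] Ex Ey.
have sum (v : R * R) : sqdist q v < w ^+ 2 -> sqdist q' v < w ^+ 2 ->
    (q.1 + q'.1 - 2 * v.1) ^+ 2 + (q.2 + q'.2 - 2 * v.2) ^+ 2 < 4 * w ^+ 2.
  rewrite /sqdist => h h'.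
  have := sqr_ge0 ((q.1 - v.1) - (q'.1 - v.1)).
  have := sqr_ge0 ((q.2 - v.2) - (q'.2 - v.2)); nra.
have {qA qA'} hA := sum _ qA qA'; have {qB qB'} hB := sum _ qB qB'.
have {qC qC' sum} hC := sum _ qC qC'.
set x := q.1 + q'.1 in Ex hA hB hC; set y := q.2 + q'.2 in Ey hA hB hC.
rewrite /vertexA /vertexB /vertexC /= !mulr0 !subr0 in hA hB hC.
have {}hA : (x + w) ^+ 2 + y ^+ 2 < 4 * w ^+ 2 by lra.
have {}hB : (x - w) ^+ 2 + y ^+ 2 < 4 * w ^+ 2 by lra.
have {}hC : x ^+ 2 + (y - Num.sqrt 3 * w) ^+ 2 < 4 * w ^+ 2 by lra.
have xw : ~ - (w / 2) < x < w / 2.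
  rewrite Ex => /andP[].
  have [k0|k0] := leP 0 k.
    have : 0 <= k%:~R * w by rewrite mulr_ge0 ?ler0z// ltW.
    by lra.
  have : k%:~R <= -1 :> R by rewrite -[-1]/((-1)%:~R) ler_int; lia.
  by nra.
have b3 := @sqrt3_bounds R; have b7 := @sqrt7_bounds R.
have b15 := @sqrt15_bounds R; have bh := @row_height_bounds R.
have s3 := @sqrt3_sqr R.
have s7 : Num.sqrt 7 ^+ 2 = 7 :> R by rewrite sqr_sqrtr.
have s15 : Num.sqrt 15 ^+ 2 = 15 :> R by rewrite sqr_sqrtr.
have [m0|[m1|[m2|m3]]] : m = 0 \/ m = -1 \/ 1 <= m \/ m <= -2.
  by clear; lia.
(* The row through the ends of the upper horizontal chord of length [w]. *)
- apply: xw; rewrite m0 mul0r add0r in Ey.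
  have y2 : y ^+ 2 = 7 / 4 * w ^+ 2 by rewrite Ey !exprMn s7; field.
  have /sqr_lt_bounds : (x + w) ^+ 2 < (3 / 2 * w) ^+ 2 by lra.
  have /sqr_lt_bounds : (x - w) ^+ 2 < (3 / 2 * w) ^+ 2 by lra.
  by clear -w0; lra.
(* The row through the ends of the lower horizontal chord of length [w]. *)
- apply: xw; rewrite m1 in Ey.
  have y2 : (y - Num.sqrt 3 * w) ^+ 2 = 15 / 4 * w ^+ 2.
    rewrite Ey (_ : _ - _ = - (Num.sqrt 15 / 2 * w)).
      by rewrite sqrrN !exprMn s15; field.
    by rewrite /row_height mulrN1z; field.
  have /sqr_lt_bounds : x ^+ 2 < (w / 2) ^+ 2 by lra.
  by clear -w0; lra.
(* Rows above the triangle. *)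
- have mh : row_height R * w <= m%:~R * (row_height R * w).
    by rewrite ler_peMl ?ler1z// mulr_ge0//; lra.
  have w1 : 0 < (row_height R + Num.sqrt 7 / 2 - Num.sqrt 3) * w.
    by rewrite mulr_gt0//; lra.
  have /sqr_lt_bounds : y ^+ 2 < (Num.sqrt 3 * w) ^+ 2.
    by rewrite exprMn s3; have := sqr_ge0 x; lra.
  have : 0 < Num.sqrt 3 * w by rewrite mulr_gt0//; lra.
  by clear -w1 mh Ey; lra.
(* Rows below the triangle. *)
- have mh : m%:~R * (row_height R * w) <= - 2 * (row_height R * w).
    rewrite ler_wpM2r//; first by rewrite mulr_ge0//; lra.
    by rewrite -[X in _ <= X]/((-2)%:~R) ler_int.
  have w1 : 0 < (2 * row_height R - Num.sqrt 7 / 2 + Num.sqrt 3 - 2) * w.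
    by rewrite mulr_gt0//; lra.
  have /sqr_lt_bounds : (y - Num.sqrt 3 * w) ^+ 2 < (2 * w) ^+ 2.
    by have := sqr_ge0 x; lra.
  by clear -w0 w1 mh Ey; lra.
Qed.

(** Multiples of [u] less than [u] apart are equal. *)
Lemma int_near {R : realType} (u : R) (k k' : int) : 0 < u ->
  - u < k%:~R * u - k'%:~R * u < u -> k = k'.
Proof.
move=> u0; rewrite -mulrBl -intrB => /andP[h1 h2].
have d1 : -1 < k - k' by rewrite -(ltr_int R) -(ltr_pM2r u0) mulrN1z mulN1r.
have d2 : k - k' < 1 by rewrite -(ltr_int R) -(ltr_pM2r u0) mul1r.
by move: d1 d2; clear; lia.
Qed.

(** * The packing *)

(** A copy is indexed by its orientation ([true] for upside-down) and the integer
    coordinates of its lattice point. *)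
Definition tile : Type := (bool * (int * int))%type.
HB.instance Definition _ := Choice.on tile.

Section packing.
Context {R : realType}.
Variable w : R.
Hypothesis w0 : 0 < w.

Let T := reuleaux w.
Let hw := row_height R * w.

(** The sign of the linear part of the isometry placing a copy. *)
Definition orient (i : tile) : R := if i.1 then -1 else 1.
(** The lattice point of a copy. *)
Definition corner (i : tile) : R * R :=
  (i.2.1%:~R * w, i.2.2%:~R * hw).
(** The image of the origin in a copy; the shift of the upside-down copies puts
    the differences of centres on the ends of the chords of [2 T]. *)
Definition center (i : tile) : R * R :=
  ((corner i).1 + (if i.1 then w / 2 else 0),
   (corner i).2 + (if i.1 then Num.sqrt 7 / 2 * w else 0)).

(** The isometry taking the triangle to its copy, and its inverse, written so
    that [area_affine] applies to it. *)
Definition place (i : tile) (p : R * R) : R * R :=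
  (orient i * p.1 + (center i).1, orient i * p.2 + (center i).2).
Definition unplace (i : tile) (p : R * R) : R * R :=
  (orient i * p.1 + - (orient i * (center i).1),
   orient i * p.2 + - (orient i * (center i).2)).

(** Upright copies own the lower half of the period rectangle at their lattice
    point, upside-down copies the upper half. *)
Definition cell (i : tile) : set (R * R) :=
  `[(corner i).1, (corner i).1 + w[%classic `*`
  `[(corner i).2 + (if i.1 then hw / 2 else 0),
    (corner i).2 + (if i.1 then hw / 2 else 0) + hw / 2[%classic.

Let hw_bounds : 15 / 10 * w < hw < 16 / 10 * w.
Proof. by rewrite /hw !ltr_pM2r// row_height_bounds. Qed.

Lemma orientP i : orient i = 1 \/ orient i = -1.
Proof. by rewrite /orient; case: ifP; [right|left]. Qed.

Lemma placeK i : cancel (place i) (unplace i).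
Proof.
move=> [x y]; rewrite /unplace /place/=.
by case: (orientP i) => ->; congr pair; ring.
Qed.

Lemma unplaceK i : cancel (unplace i) (place i).
Proof.
move=> [x y]; rewrite /unplace /place/=.
by case: (orientP i) => ->; congr pair; ring.
Qed.

Lemma image_place i A : place i @` A = unplace i @^-1` A.
Proof.
apply/seteqP; split => [_ [p Ap <-]|p /= Ap]; first by rewrite /= placeK.
by exists (unplace i p) => //; exact: unplaceK.
Qed.

Lemma sqdist_unplace i p q : sqdist p (place i q) = sqdist (unplace i p) q.
Proof.
by rewrite /sqdist /unplace /place/=; case: (orientP i) => ->; ring.
Qed.

Lemma place_isometry i : plane_isometry (place i).
Proof.
move=> p q; rewrite /Defs.edist -/(sqdist _ _) sqdist_unplace placeK//.
Qed.

Let X i : set (R * R) := place i @` T.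
Let Y i : set (R * R) := unplace i @^-1` reuleaux_open w.

Lemma interior_copy i : interior (X i : set (R * R)%type) `<=` Y i.
Proof.
have sub v : T `<=` closed_disk v w ->
    interior (X i) `<=` [set p | sqdist (unplace i p) v < w ^+ 2].
  move=> Tv p Xp; rewrite /= -sqdist_unplace.
  apply: (interior_closed_disk (place i v) w w0).
  move: Xp; apply: interiorS => _ [q Tq <-].
  by rewrite /closed_disk/= place_isometry; exact: Tv.
move=> p Xp; split; (apply: sub Xp => q; rewrite /T /reuleaux => -[[]]); by [].
Qed.

Lemma copies_disjoint i j p : Y i p -> Y j p -> i = j.
Proof.
have h0 : 0 < hw by have := hw_bounds; lra.
have hb := hw_bounds.
case: i => [b [k m]]; case: j => [b' [k' m']].
rewrite /Y /unplace /center /corner /orient /=.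
case: b; case: b' => /= Hi Hj.
(* Equal orientations: the extents of the triangle are at most the periods. *)
- have [/= e1 e2] := reuleaux_open_extent _ _ w0 Hi.
  have [/= e1' e2'] := reuleaux_open_extent _ _ w0 Hj.
  by congr (_, (_, _)); [apply: (int_near w)|apply: (int_near hw)] => //; lra.
(* Opposite orientations: add the two pulled-back points. *)
- exfalso; apply: (opposite_disjoint w _ _ (k - k') (m - m') w0 Hi Hj) => /=.
    by rewrite intrB; ring.
  by rewrite intrB -/hw; ring.
- exfalso; apply: (opposite_disjoint w _ _ (k' - k) (m' - m) w0 Hi Hj) => /=.
    by rewrite intrB; ring.
  by rewrite intrB -/hw; ring.
- have [/= e1 e2] := reuleaux_open_extent _ _ w0 Hi.
  have [/= e1' e2'] := reuleaux_open_extent _ _ w0 Hj.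
  by congr (_, (_, _)); [apply: (int_near w)|apply: (int_near hw)] => //; lra.
Qed.

Lemma reuleaux_packing : is_packing T (range X).
Proof.
split=> [_ [i _ <-]|]; first by exists (place i) => //; exact: place_isometry.
move=> _ _ [i _ <-] [j _ <-] [p [Xi Xj]]; congr X.
by apply: (copies_disjoint i j p); exact: interior_copy.
Qed.

Lemma cells_disjoint i j p : cell i p -> cell j p -> i = j.
Proof.
have h0 : 0 < hw by have := hw_bounds; lra.
case: i => [b [k m]]; case: j => [b' [k' m']].
rewrite /cell /corner /= => -[/=]; rewrite ?in_itv/= => /andP[a1 a2] /andP[a3 a4].
move=> -[/=]; rewrite ?in_itv/= => /andP[a5 a6] /andP[a7 a8].
have ek : k = k' by apply: (int_near w) => //; lra.
have em : m = m'.
  by apply: (int_near hw) => //; move: a3 a4 a7 a8; case: b; case: b'; lra.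
move: a3 a4 a7 a8; rewrite ek em; case: b; case: b' => // a3 a4 a7 a8; exfalso; lra.
Qed.

Lemma cells_cover : \bigcup_i cell i = setT.
Proof.
have h0 : 0 < hw by have := hw_bounds; lra.
apply/seteqP; split => // -[x y] _.
have [fx1 fx2] : (Num.floor (x / w))%:~R * w <= x /\
    x < (Num.floor (x / w))%:~R * w + w.
  split; first by rewrite -ler_pdivlMr// floor_le_tmp.
  by rewrite -[X in _ + X]mul1r -mulrDl -ltr_pdivrMr// -intrD1 floorD1_gt.
have [fy1 fy2] : (Num.floor (y / hw))%:~R * hw <= y /\
    y < (Num.floor (y / hw))%:~R * hw + hw.
  split; first by rewrite -ler_pdivlMr// floor_le_tmp.
  by rewrite -[X in _ + X]mul1r -mulrDl -ltr_pdivrMr// -intrD1 floorD1_gt.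
exists ((Num.floor (y / hw))%:~R * hw + hw / 2 <= y,
  (Num.floor (x / w), Num.floor (y / hw))) => //.
rewrite /cell /corner/=; split; rewrite /= in_itv/=; first by rewrite fx1.
by case: (leP ((Num.floor (y / hw))%:~R * hw + hw / 2) y) => /= ?; lra.
Qed.

Let mX i : measurable (X i : set (plane R)).
Proof.
rewrite /X image_place -[X in measurable X]setTI.
apply: (measurable_affine2 (orient i)
  (- (orient i * (center i).1), - (orient i * (center i).2))) => //.
by apply: measurableI; [apply: measurableI|]; exact: measurable_closed_disk.
Qed.

Let mT : measurable (T : set (plane R)).
Proof. by apply: measurableI; [apply: measurableI|]; exact: measurable_closed_disk. Qed.

Let mTo : measurable (reuleaux_open w : set (plane R)).
Proof.
rewrite (_ : reuleaux_open w = [set p | sqdist p (vertexA w) < w ^+ 2] `&`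
  [set p | sqdist p (vertexB w) < w ^+ 2] `&` [set p | sqdist p (vertexC w) < w ^+ 2]).
  by apply: measurableI; [apply: measurableI|]; exact: measurable_open_disk.
by apply/seteqP; split => p /=; [case=> ? ? ?|case=> -[? ?] ?].
Qed.

Let mY i : measurable (Y i : set (plane R)).
Proof.
rewrite /Y -[X in measurable X]setTI.
by apply: (measurable_affine2 (orient i)
  (- (orient i * (center i).1), - (orient i * (center i).2))).
Qed.

Let oT : reuleaux_open w `<=` T.
Proof. by move=> p [? ? ?]; apply/reuleauxP; [exact: ltW|split; exact: ltW]. Qed.

Let alpha := (pi - Num.sqrt 3) / 2 * w ^+ 2.

Let areaX i : mu2 R (X i) = alpha%:E.
Proof.
rewrite /X image_place -(area_reuleaux w T w0 mT oT (@subset_refl _ _)).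
exact: (area_affine _
  (- (orient i * (center i).1), - (orient i * (center i).2)) (orientP i)).
Qed.

Let areaY i : mu2 R (Y i) = alpha%:E.
Proof.
rewrite -(area_reuleaux w _ w0 mTo (@subset_refl _ _) oT).
exact: (area_affine _
  (- (orient i * (center i).1), - (orient i * (center i).2)) (orientP i)).
Qed.

Let areaQ i : mu2 R (cell i) = (w * (hw / 2))%:E.
Proof.
have h0 : 0 < hw by have := hw_bounds; lra.
rewrite /cell product_measure1E//.
rewrite EFinM; congr (_ * _)%E.
  by rewrite [LHS]lebesgue_measure_bounded_itv ?lerDl ?ltW// addrAC subrr add0r.
rewrite [LHS]lebesgue_measure_bounded_itv; first by rewrite addrAC subrr add0r.
by rewrite lerDl divr_ge0// ltW.
Qed.

Let near_corner i p : (X i `|` cell i) p ->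
  `|p.1 - (corner i).1| <= 2 * w /\ `|p.2 - (corner i).2| <= 3 * w.
Proof.
have hb := hw_bounds; have b7 := @sqrt7_bounds R.
have b7w : 0 <= Num.sqrt 7 / 2 * w <= 2 * w.
  by move/andP: b7 => [? ?]; apply/andP; split; nra.
rewrite !ler_norml => -[[q /(reuleauxP _ _ (ltW w0)) [+ + _] <-]|].
  rewrite /sqdist/= !subr0 => hA hB.
  have q1 : - w <= q.1 <= w.
    by apply: (sqr_le_bounds _ _ (ltW w0)); have := sqr_ge0 q.2; nra.
  have q2 : - w <= q.2 <= w.
    apply: (sqr_le_bounds _ _ (ltW w0)).
    by have := sqr_ge0 (q.1 - - (w / 2)); lra.
  rewrite /place /center /orient/=; case: (i.1); lra.
rewrite /cell/= => -[/=]; rewrite ?in_itv/=; case: (i.1); lra.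
Qed.

Let near_cell i p q : (X i `|` cell i) p -> (X i `|` cell i) q ->
  Defs.edist p q <= 12 * w.
Proof.
move=> /near_corner[+ +] /near_corner[]; rewrite !ler_norml => q1 q2 p1 p2.
rewrite edist_le; last by rewrite mulr_ge0// ltW.
have d1 : (p.1 - q.1) ^+ 2 <= (4 * w) ^+ 2.
  rewrite -(@real_normK _ (p.1 - q.1)) ?num_real// ler_sqr ?nnegrE ?mulr_ge0 ?(ltW w0)//.
  by rewrite ler_norml; lra.
have d2 : (p.2 - q.2) ^+ 2 <= (6 * w) ^+ 2.
  rewrite -(@real_normK _ (p.2 - q.2)) ?num_real// ler_sqr ?nnegrE ?mulr_ge0 ?(ltW w0)//.
  by rewrite ler_norml; lra.
have := sqr_ge0 w; rewrite /sqdist; lra.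
Qed.

Lemma reuleaux_density : has_density (range X)
  (2 * (pi - Num.sqrt 3) / (Num.sqrt 15 + Num.sqrt 7 - 2 * Num.sqrt 3)).
Proof.
have h0 : 0 < hw by have := hw_bounds; lra.
have bh := @row_height_bounds R.
have rhE : Num.sqrt 15 + Num.sqrt 7 - 2 * Num.sqrt 3 = 2 * row_height R.
  by rewrite /row_height; field.
rewrite rhE.
have -> : 2 * (pi - Num.sqrt 3) / (2 * row_height R) = alpha / (w * (hw / 2)).
  by rewrite /alpha /hw; field; rewrite !gt_eqF//; lra.
have s3pi : Num.sqrt 3 <= (pi : R).
  by have := @sqrt3_bounds R; have := pi_ge2 R; lra.
apply: (density_cells X Y cell alpha (w * (hw / 2)) (12 * w)) => //.
- by rewrite /alpha mulr_ge0 ?sqr_ge0// divr_ge0// subr_ge0.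
- by rewrite mulr_gt0// divr_gt0.
- by rewrite mulr_gt0.
- by move=> i; apply: measurableX.
- by move=> i p Yp; rewrite /X image_place; exact: oT.
- by move=> i j _ _ [p [Yi Yj]]; exact: (copies_disjoint i j p).
- by move=> i j _ _ [p [Yi Yj]]; exact: (cells_disjoint i j p).
- exact: cells_cover.
Qed.

End packing.

Theorem mainTheorem3 (R : realType) (w : R) (w_gt0 : 0 < w) :
  exists (T : set (R * R)) (P : set (set (R * R))),
    [/\ reuleaux_triangle w T,
        is_packing T P &
        has_density P
          (2 * (pi - Num.sqrt 3) / (Num.sqrt 15 + Num.sqrt 7 - 2 * Num.sqrt 3))].
Proof.
exists (reuleaux w), (range (fun i => place w i @` reuleaux w)); split.
- exact: reuleaux_isP.
- exact: reuleaux_packing.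
- exact: reuleaux_density.
Qed.
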